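(* Let $z>0$, let $L[p]=\int_{-z}^{z}p(x)e^{-x^{2}}\,dx$ for $p\in\mathbb{R}[x]$, and let $\phi(x;z)=x^{2}-z^{2}$ and $\psi(x;z)=2x\,\phi(x;z)$. Then for every $p\in\mathbb{R}[x]$, $$L\left[\partial_{x}(\phi p)\right]=L\left[\psi p\right],$$ or equivalently, for every $p\in\mathbb{R}[x]$, $$L\left[\phi\,\partial_{x}p\right]=L\left[2x(\phi-1)p\right].$$
   Context: $\partial_x$ denotes the derivative with respect to $x$. *)

(* Defs.v *)
From HB Require Import structures.
From mathcomp Require Import all_boot all_order all_algebra.
From mathcomp Require Import all_classical all_reals all_analysis.

Set Implicit Arguments.
Unset Strict Implicit.
Unset Printing Implicit Defensive.

Import Order.TTheory GRing.Theory Num.Theory.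
Import numFieldNormedType.Exports.

Local Open Scope classical_set_scope.
Local Open Scope ring_scope.

(* The integrand is continuous on a compact interval, hence integrable, so the
   real-valued Lebesgue integral below is the usual one (no junk value). *)
Definition L {R : realType} (z : R) (p : {poly R}) : R :=
  \int[lebesgue_measure]_(x in `[- z, z]) (p.[x] * expR (- x ^+ 2)).

Definition phi {R : realType} (z : R) : {poly R} := 'X ^+ 2 - (z ^+ 2)%:P.

Definition psi {R : realType} (z : R) : {poly R} := 2%:P * 'X * phi z.

(* Main.v *)
(* The function q(x) exp(-x^2) has derivative (q' - 2xq)(x) exp(-x^2), so
   L[q' - 2xq] is the boundary term (q(z) - q(-z)) exp(-z^2). It vanishes for
   q = phi p because phi(z) = phi(-z) = 0. Since phi' = 2x, the second identity
   follows by subtracting L[2xp] from both sides of the first. *)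
Require Import Defs.
From HB Require Import structures.
From mathcomp Require Import all_boot all_order all_algebra.
From mathcomp Require Import all_classical all_reals all_analysis.
From mathcomp Require Import ring.

Set Implicit Arguments.
Unset Strict Implicit.
Unset Printing Implicit Defensive.

Import Order.TTheory GRing.Theory Num.Theory.
Import numFieldNormedType.Exports.

Local Open Scope classical_set_scope.
Local Open Scope ring_scope.

(** Product and chain rules. The polynomial factor is kept in one piece so that the derivative is
    again an integrand of the form used in [L]. *)
Lemma is_derive_horner_gauss (R : realType) (q : {poly R}) (x : R) :
  is_derive x 1 (fun y : R => q.[y] * expR (- y ^+ 2))
    ((q^`() - 2%:P * 'X * q).[x] * expR (- x ^+ 2)).
Proof.
have dg : is_derive x 1 (fun y : R => expR (- y ^+ 2))
    (expR (- x ^+ 2) * - (2 * x)).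
  have d2 : is_derive x 1 (fun y : R => - y ^+ 2) (- (2 * x)).
    by apply: is_derive_eq; rewrite /GRing.scale /=; ring.
  exact: (@is_derive1_comp R (@expR R) (fun y => - y ^+ 2)).
apply: (is_derive_eq (@is_deriveM _ _ (horner q) _ x 1 _ _
  (is_derive_poly q x) dg)).
by rewrite !hornerE /GRing.scale /=; ring.
Qed.

Lemma continuous_horner_gauss (R : realType) (q : {poly R}) :
  continuous (fun y : R => q.[y] * expR (- y ^+ 2)).
Proof.
move=> x; apply/differentiable_continuous/derivable1_diffP.
exact: (@ex_derive _ _ _ _ _ _ _ (is_derive_horner_gauss q x)).
Qed.

Lemma integrable_horner_gauss (R : realType) (z : R) (q : {poly R}) :
  (@lebesgue_measure R).-integrable `[- z, z]
    (EFin \o (fun x : R => q.[x] * expR (- x ^+ 2))).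
Proof.
apply: continuous_compact_integrable; first exact: segment_compact.
exact/continuous_subspaceT/continuous_horner_gauss.
Qed.

Lemma L_sub (R : realType) (z : R) (p q : {poly R}) :
  L z (p - q) = L z p - L z q.
Proof.
rewrite /L -RintegralB //; [|exact: integrable_horner_gauss..].
by apply: eq_Rintegral => x _; rewrite hornerD hornerN mulrBl.
Qed.

(** Fundamental theorem of calculus for [F]; the Gaussian is even, so both endpoints carry the same
    factor. *)
Lemma L_deriv_gauss (R : realType) (z : R) (q : {poly R}) : 0 < z ->
  L z (q^`() - 2%:P * 'X * q) = (q.[z] - q.[- z]) * expR (- z ^+ 2).
Proof.
move=> z0; pose F (y : R) := q.[y] * expR (- y ^+ 2).
rewrite /L /Rintegral (@continuous_FTC2 R _ F) /=.
- by rewrite /F sqrrN mulrBl.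
- by rewrite gtrN.
- exact/continuous_subspaceT/continuous_horner_gauss.
- split.
  + by move=> x _; exact: (@ex_derive _ _ _ _ _ _ _ (is_derive_horner_gauss q x)).
  + exact/cvg_at_right_filter/continuous_horner_gauss.
  + exact/cvg_at_left_filter/continuous_horner_gauss.
- move=> x _; rewrite derive1E.
  exact: (@derive_val _ _ _ _ _ _ _ (is_derive_horner_gauss q x)).
Qed.

Theorem proposition3 (R : realType) (z : R) (hz : 0 < z) :
  (forall p : {poly R}, L z ((phi z * p)^`()) = L z (psi z * p)) /\
  (forall p : {poly R},
     L z (phi z * p^`()) = L z (2%:P * 'X * (phi z - 1) * p)).
Proof.
have ibp (p : {poly R}) : L z ((phi z * p)^`()) = L z (psi z * p).
  (* Reassociating [psi z * p] as [2x * (phi z * p)] makes the difference of the two sides an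
     instance of [L_deriv_gauss] with [q = phi z * p]. *)
  apply/eqP; rewrite /psi -mulrA -subr_eq0 -L_sub L_deriv_gauss //.
  by rewrite /phi !hornerE sqrrN subrr !mul0r subrr mul0r.
split=> // p.
have dphi : (phi z)^`() = 2%:P * 'X.
  by rewrite /phi derivB derivC subr0 derivXn /= expr1 -mulr_natl polyC_natr.
have -> : phi z * p^`() = (phi z * p)^`() - 2%:P * 'X * p.
  by rewrite derivM dphi addrAC subrr add0r.
(* The integrands now agree as polynomials: [2x * phi * p - 2x * p = 2x * (phi - 1) * p]. *)
by rewrite L_sub ibp -L_sub /psi; congr (L z _); ring.
Qed.
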